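(* Let $M$ be an $F$-anti invariant Lagrangian submanifold in an arbitrary Kähler product manifold $\overline{M}^m\times\overline{M}^n$. Then $M$ is totally geodesic.
   Context: $\overline{M}^m$ and $\overline{M}^n$ are Kähler manifolds of complex dimensions $m$ and $n$ (no curvature assumption), and $\overline{M}=\overline{M}^m\times\overline{M}^n$ carries the product metric $g$ and product complex structure $J$. $F=\overline{P}-\overline{Q}$ is the almost product structure on $\overline{M}$, where $\overline{P},\overline{Q}$ are the projections of $T\overline{M}$ onto the tangent spaces of the first and second factor. $M$ is a real submanifold of $\overline{M}$ with induced metric; it is $F$-anti invariant if $F(T_xM)\subset T_x(M)^\bot$ for all $x\in M$, and Lagrangian if $J(T_xM)=T_x(M)^\bot$ for all $x\in M$ (so its real dimension is $m+n$, half that of $\overline{M}$). Totally geodesic means the second fundamental form of $M$ in $\overline{M}$ vanishes. *)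

(* Defs.v *)
From HB Require Import structures.
From mathcomp Require Import all_boot all_order all_algebra.
From mathcomp Require Import all_classical all_reals all_analysis.

Set Implicit Arguments.
Unset Strict Implicit.
Unset Printing Implicit Defensive.

Import Order.TTheory GRing.Theory Num.Theory.
Import numFieldNormedType.Exports.
Local Open Scope classical_set_scope.
Local Open Scope ring_scope.

Section Smoothness.
Context {R : realType}.

Fixpoint Ck {n : nat} {W : normedModType R} (k : nat)
    (U : set 'rV[R]_n) (f : 'rV[R]_n -> W) : Prop :=
  match k with
  | 0 => forall u, U u -> {for u, continuous f}
  | k'.+1 => (forall u, U u -> differentiable f u) /\
             (forall i : 'I_n, Ck k' U ('D_('e_i) f))
  end.

Definition smooth {n : nat} {W : normedModType R}
    (U : set 'rV[R]_n) (f : 'rV[R]_n -> W) : Prop := forall k, Ck k U f.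

End Smoothness.

Section SmoothTheory.
Context {R : realType}.

Lemma near_eq_differentiable (V W : normedModType R) (f g : V -> W) (x : V) :
  (\near x, f x = g x) -> differentiable f x -> differentiable g x.
Proof.
move=> fg df; have fgx := nbhs_singleton fg.
have dE : g \o shift x = cst (g x) + 'd f x +o_ 0 id.
  apply/eqaddoP => e e0.
  have /eqaddoP/(_ e e0) := diff_locally df.
  have : \forall h \near (0 : V), f (h + x) = g (h + x).
    by move: fg; rewrite (near_shift 0 x) subr0.
  apply: filter_app2; near=> h => /= fgh.
  by rewrite !fctE /= -fgh -fgx.
apply/diff_locallyP.
have -> : 'd g x = 'd f x :> (V -> W).
  exact: diff_unique (diff_continuous df) dE.
by split => //; exact: diff_continuous.
Unshelve. all: by end_near. Qed.

Lemma open_near_eq n (W : normedModType R) (U : set 'rV[R]_n)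
    (f g : 'rV[R]_n -> W) u :
  open U -> (forall v, U v -> f v = g v) -> U u -> \near u, f u = g u.
Proof.
by move=> oU fg Uu; near=> v; apply: fg; near: v; exact: open_nbhs_nbhs.
Unshelve. all: by end_near. Qed.

Lemma Ck_eq n (W : normedModType R) k (U : set 'rV[R]_n)
    (f g : 'rV[R]_n -> W) :
  open U -> (forall u, U u -> f u = g u) -> Ck k U f -> Ck k U g.
Proof.
move=> oU; elim: k f g => [|k IH] f g fg /=.
  move=> cf u Uu; suff: g @ u --> f u by rewrite fg.
  have /near_eq_cvg gf := open_near_eq oU fg Uu.
  exact: cvg_trans gf (cf u Uu).
move=> [df Df]; split => [u Uu|i].
  by apply: near_eq_differentiable (df u Uu); exact: open_near_eq oU fg Uu.
apply: IH (Df i) => u Uu.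
by apply: near_eq_derive; exact: open_near_eq oU fg Uu.
Qed.

Lemma Ck_sub n (W : normedModType R) k (U V : set 'rV[R]_n)
    (f : 'rV[R]_n -> W) : V `<=` U -> Ck k U f -> Ck k V f.
Proof.
move=> VU; elim: k f => [|k IH] f /= => [cf u /VU|[df Df]]; first exact: cf.
by split => [u /VU|i]; [exact: df|exact: IH].
Qed.

Lemma Ck_linear n (W W' : normedModType R) k (U : set 'rV[R]_n)
    (L : {linear W -> W'}) (f : 'rV[R]_n -> W) :
  open U -> continuous L -> Ck k U f -> Ck k U (L \o f).
Proof.
move=> oU cL; elim: k f => [|k IH] f /=.
  by move=> cf u Uu; apply: continuous_comp; [exact: cf|exact: cL].
move=> [df Df]; split => [u Uu|i].
  apply: differentiable_comp; first exact: df.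
  exact: linear_differentiable.
apply: (@Ck_eq _ _ _ _ (L \o 'D_('e_i) f)) => //; last exact: IH.
move=> u Uu; have dfu := df u Uu; have dL := linear_differentiable (f u) cL.
rewrite /= (deriveE _ dfu) (deriveE _ (differentiable_comp dfu dL)).
rewrite (diff_comp dfu dL) /=.
exact/esym/(congr1 (@^~ ('d f u 'e_i)) (diff_lin (f u) cL)).
Qed.

Lemma Ck_add n (W : normedModType R) k (U : set 'rV[R]_n)
    (f g : 'rV[R]_n -> W) :
  open U -> Ck k U f -> Ck k U g -> Ck k U (f + g).
Proof.
move=> oU; elim: k f g => [|k IH] f g /=.
  by move=> cf cg u Uu; apply: continuousD; [exact: cf|exact: cg].
move=> [df Df] [dg Dg]; split => [u Uu|i].
  by apply: differentiableD; [exact: df|exact: dg].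
apply: (@Ck_eq _ _ _ _ ('D_('e_i) f + 'D_('e_i) g)) => //.
  move=> u Uu; rewrite deriveD//; apply: diff_derivable.
    exact: df.
  exact: dg.
exact: IH.
Qed.

Lemma derive_comp_linear n p (W : normedModType R)
    (L : {linear 'rV[R]_n -> 'rV[R]_p}) (f : 'rV[R]_p -> W) (v u : 'rV[R]_n) :
  'D_v (f \o L) u = 'D_(L v) f (L u).
Proof.
rewrite /derive (_ : (fun h : R => _) =
  (fun h => h^-1 *: ((f \o shift (L u)) (h *: L v) - f (L u))))//.
by apply/funext => h /=; rewrite -(linearP L).
Qed.

Lemma Ck_cst n (W : normedModType R) k (U : set 'rV[R]_n) (w : W) :
  Ck k U (cst w : 'rV[R]_n -> W).
Proof.
elim: k w => [|k IH] w /=; first by move=> u _; exact: cst_continuous.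
split => [u _|j]; first exact: differentiable_cst.
rewrite (_ : 'D_ _ _ = cst 0); first exact: IH.
by apply/funext => u; rewrite derive_cst.
Qed.

Lemma Ck_comp_linear n p (W : normedModType R) k (U : set 'rV[R]_p)
    (L : {linear 'rV[R]_n -> 'rV[R]_p}) (f : 'rV[R]_p -> W) :
  continuous L ->
  (forall i, L ('e_i) = 0 \/ exists j, L ('e_i) = 'e_j) ->
  Ck k U f -> Ck k (L @^-1` U) (f \o L).
Proof.
move=> cL Ldelta; elim: k f => [|k IH] f /=.
  by move=> cf u Uu; apply: continuous_comp; [exact: cL|exact: cf].
move=> [df Df]; split => [u Uu|i].
  apply: differentiable_comp; first exact: linear_differentiable.
  exact: df.
rewrite (_ : 'D_('e_i) (f \o L) = 'D_(L ('e_i)) f \o L); last first.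
  by apply/funext => u; rewrite /= derive_comp_linear.
have [->|[j ->]] := Ldelta i; last exact: IH.
rewrite (_ : _ \o _ = cst 0); last by apply/funext => u /=; rewrite derive0.
exact: Ck_cst.
Qed.

Lemma continuous_sum (I : Type) (r : seq I) (P : pred I) (T : topologicalType)
    (W : normedModType R) (F : I -> T -> W) :
  (forall i, P i -> continuous (F i)) ->
  continuous (fun x => \sum_(i <- r | P i) F i x).
Proof.
move=> cF x; apply: cvg_big => [|i Pi].
  exact: add_continuous.
exact: cF.
Qed.

Lemma linear_mx_continuous p q (W : normedModType R)
  (L : {linear 'M[R]_(p, q) -> W}) : continuous L.
Proof.
rewrite (_ : (L : _ -> _) =
  fun A => \sum_i \sum_j A i j *: L (delta_mx i j)); last first.
  apply/funext => A; rewrite {1}[A]matrix_sum_delta linear_sum.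
  apply: eq_bigr => i _; rewrite linear_sum; apply: eq_bigr => j _.
  by rewrite linearZ.
apply: continuous_sum => i _; apply: continuous_sum => j _ A.
by apply: continuousZr_tmp; exact: matrix_normedtype.coord_continuous.
Qed.

Lemma block_diag_mulE p q (A : 'M[R]_p) (B : 'M[R]_q) :
  block_mx A 0 0 B = (mulmxr (row_mx 1%:M 0) \o mulmx (col_mx 1%:M 0)) A
                     + (mulmxr (row_mx 0 1%:M) \o mulmx (col_mx 0 1%:M)) B.
Proof.
rewrite /= !mul_col_mx !mul1mx !mul0mx !mul_mx_row !mulmx1 !mulmx0.
by rewrite add_col_mx addr0 add0r block_mxEv.
Qed.

Lemma row_mx_mulE p q (v : 'rV[R]_p) (w : 'rV[R]_q) :
  row_mx v w = mulmxr (row_mx 1%:M 0) v + mulmxr (row_mx 0 1%:M) w.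
Proof. by rewrite /= !mul_mx_row !mulmx1 !mulmx0 add_row_mx addr0 add0r. Qed.

Lemma lsubmx_e_lshift p q (i : 'I_p) : lsubmx ('e_(lshift q i)) = 'e_i :> 'rV[R]_p.
Proof. by apply/rowP => k; rewrite !mxE eqxx /= (inj_eq (@lshift_inj _ _)). Qed.

Lemma rsubmx_e_lshift p q (i : 'I_p) : rsubmx ('e_(lshift q i)) = 0 :> 'rV[R]_q.
Proof. by apply/rowP => k; rewrite !mxE eqxx /= eq_rlshift. Qed.

Lemma lsubmx_e_rshift p q (i : 'I_q) : lsubmx ('e_(rshift p i)) = 0 :> 'rV[R]_p.
Proof. by apply/rowP => k; rewrite !mxE eqxx /= eq_lrshift. Qed.

Lemma rsubmx_e_rshift p q (i : 'I_q) : rsubmx ('e_(rshift p i)) = 'e_i :> 'rV[R]_q.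
Proof. by apply/rowP => k; rewrite !mxE eqxx /= (inj_eq (@rshift_inj _ _)). Qed.

Lemma lsubmx_delta p q (i : 'I_(p + q)) :
  lsubmx ('e_i : 'rV[R]_(p + q)) = 0 \/
  exists j, lsubmx ('e_i : 'rV[R]_(p + q)) = 'e_j.
Proof.
have := fintype.splitK i; case: (fintype.split i) => j /= <-.
  by right; exists j; rewrite lsubmx_e_lshift.
by left; rewrite lsubmx_e_rshift.
Qed.

Lemma rsubmx_delta p q (i : 'I_(p + q)) :
  rsubmx ('e_i : 'rV[R]_(p + q)) = 0 \/
  exists j, rsubmx ('e_i : 'rV[R]_(p + q)) = 'e_j.
Proof.
have := fintype.splitK i; case: (fintype.split i) => j /= <-.
  by left; rewrite rsubmx_e_lshift.
by right; exists j; rewrite rsubmx_e_rshift.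
Qed.

Definition split_preimage p q (U : set 'rV[R]_p) (V : set 'rV[R]_q) :
    set 'rV[R]_(p + q) := [set u | U (lsubmx u) /\ V (rsubmx u)].

Lemma open_split_preimage p q (U : set 'rV[R]_p) (V : set 'rV[R]_q) :
  open U -> open V -> open (split_preimage U V).
Proof.
move=> oU oV; apply: openI.
  by apply: open_comp => // u _; exact: continuous_lsubmx.
by apply: open_comp => // u _; exact: continuous_rsubmx.
Qed.

Lemma smooth_split p q (W1 W2 W : normedModType R)
    (L1 : {linear W1 -> W}) (L2 : {linear W2 -> W})
    (U : set 'rV[R]_p) (V : set 'rV[R]_q)
    (f : 'rV[R]_p -> W1) (g : 'rV[R]_q -> W2) :
  open U -> open V -> continuous L1 -> continuous L2 ->
  smooth U f -> smooth V g ->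
  smooth (split_preimage U V)
         (fun u : 'rV[R]_(p + q) => L1 (f (lsubmx u)) + L2 (g (rsubmx u))).
Proof.
move=> oU oV c1 c2 sf sg k.
have oUV := open_split_preimage oU oV.
rewrite (_ : (fun u => _) = (L1 \o (f \o lsubmx)) + (L2 \o (g \o rsubmx)))//.
apply: Ck_add => //.
  apply: Ck_linear => //; apply: (@Ck_sub _ _ _ (lsubmx @^-1` U)).
    by move=> u [].
  apply: (Ck_comp_linear (L := lsubmx)) (sf k).
    exact: continuous_lsubmx.
  exact: lsubmx_delta.
apply: Ck_linear => //; apply: (@Ck_sub _ _ _ (rsubmx @^-1` V)).
  by move=> u [].
apply: (Ck_comp_linear (L := rsubmx)) (sg k).
  exact: continuous_rsubmx.
exact: rsubmx_delta.
Qed.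

Lemma smooth_block_diag p q (U : set 'rV[R]_p) (V : set 'rV[R]_q)
    (A : 'rV[R]_p -> 'M[R]_p) (B : 'rV[R]_q -> 'M[R]_q) :
  open U -> open V -> smooth U A -> smooth V B ->
  smooth (split_preimage U V)
         (fun u => block_mx (A (lsubmx u)) 0 0 (B (rsubmx u))).
Proof.
move=> oU oV sA sB; under [X in smooth _ X]eq_fun do rewrite block_diag_mulE.
by apply: smooth_split => //; exact: linear_mx_continuous.
Qed.

Lemma smooth_row_mx p q p' q' (U : set 'rV[R]_p) (V : set 'rV[R]_q)
    (f : 'rV[R]_p -> 'rV[R]_p') (g : 'rV[R]_q -> 'rV[R]_q') :
  open U -> open V -> smooth U f -> smooth V g ->
  smooth (split_preimage U V)
         (fun u => row_mx (f (lsubmx u)) (g (rsubmx u))).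
Proof.
move=> oU oV sf sg; under [X in smooth _ X]eq_fun do rewrite row_mx_mulE.
by apply: smooth_split => //; exact: linear_mx_continuous.
Qed.

Lemma smooth_differentiable n (W : normedModType R) (U : set 'rV[R]_n)
    (f : 'rV[R]_n -> W) u : smooth U f -> U u -> differentiable f u.
Proof. by move=> sf; have [+ _] := sf 1; exact. Qed.

Lemma derive_split p q (W1 W2 W : normedModType R)
    (L1 : {linear W1 -> W}) (L2 : {linear W2 -> W})
    (f : 'rV[R]_p -> W1) (g : 'rV[R]_q -> W2) (u v : 'rV[R]_(p + q)) :
  continuous L1 -> continuous L2 ->
  differentiable f (lsubmx u) -> differentiable g (rsubmx u) ->
  'D_v (fun u : 'rV[R]_(p + q) => L1 (f (lsubmx u)) + L2 (g (rsubmx u))) u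
  = L1 ('D_(lsubmx v) f (lsubmx u)) + L2 ('D_(rsubmx v) g (rsubmx u)).
Proof.
move=> c1 c2 df dg.
have dfl : differentiable (f \o lsubmx) u.
  by apply: differentiable_comp => //; exact: differentiable_lsubmx.
have dgr : differentiable (g \o rsubmx) u.
  by apply: differentiable_comp => //; exact: differentiable_rsubmx.
have dL1 := linear_differentiable (f (lsubmx u)) c1.
have dL2 := linear_differentiable (g (rsubmx u)) c2.
have d1 : differentiable (L1 \o (f \o lsubmx)) u by exact: differentiable_comp.
have d2 : differentiable (L2 \o (g \o rsubmx)) u by exact: differentiable_comp.
rewrite (_ : (fun u => _) = (L1 \o (f \o lsubmx)) + (L2 \o (g \o rsubmx)))//.
rewrite deriveD; [|exact: diff_derivable|exact: diff_derivable].
rewrite (deriveE _ d1) (deriveE _ d2) (diff_comp dfl dL1) (diff_comp dgr dL2) /=.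
have -> := congr1 (@^~ ('d (f \o lsubmx) u v)) (diff_lin (f (lsubmx u)) c1).
have -> := congr1 (@^~ ('d (g \o rsubmx) u v)) (diff_lin (g (rsubmx u)) c2).
by rewrite -!deriveE// !derive_comp_linear.
Qed.

Lemma derive_block_diag p q (A : 'rV[R]_p -> 'M[R]_p) (B : 'rV[R]_q -> 'M[R]_q)
    (u v : 'rV[R]_(p + q)) :
  differentiable A (lsubmx u) -> differentiable B (rsubmx u) ->
  'D_v (fun u => block_mx (A (lsubmx u)) 0 0 (B (rsubmx u))) u
  = block_mx ('D_(lsubmx v) A (lsubmx u)) 0 0 ('D_(rsubmx v) B (rsubmx u)).
Proof.
move=> dA dB; under [X in derive X]eq_fun do rewrite block_diag_mulE.
by rewrite derive_split ?block_diag_mulE//; exact: linear_mx_continuous.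
Qed.

Lemma jacobian_row_mx p q p' q' (f : 'rV[R]_p -> 'rV[R]_p')
    (g : 'rV[R]_q -> 'rV[R]_q') (u : 'rV[R]_(p + q)) :
  differentiable f (lsubmx u) -> differentiable g (rsubmx u) ->
  'J (fun u => row_mx (f (lsubmx u)) (g (rsubmx u))) u
  = block_mx ('J f (lsubmx u)) 0 0 ('J g (rsubmx u)).
Proof.
move=> df dg; have dfg : differentiable (fun u => row_mx (f (lsubmx u)) (g (rsubmx u))) u.
  under eq_fun do rewrite row_mx_mulE.
  apply: differentiableD; apply: (@differentiable_comp _ _ _ _ _ (mulmxr _)).
  - by apply: differentiable_comp => //; exact: differentiable_lsubmx.
  - exact: linear_differentiable (@linear_mx_continuous _ _ _ _).
  - by apply: differentiable_comp => //; exact: differentiable_rsubmx.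
  - exact: linear_differentiable (@linear_mx_continuous _ _ _ _).
apply/row_matrixP => i; rewrite !rowE -deriveEjacobian//.
under [X in derive X]eq_fun do rewrite row_mx_mulE.
rewrite derive_split//; [|exact: linear_mx_continuous|exact: linear_mx_continuous].
rewrite !deriveEjacobian// -row_mx_mulE -{3}['e_i]hsubmxK.
by rewrite mul_row_block !mulmx0 addr0 add0r.
Qed.

Lemma smooth_sub n (W : normedModType R) (U V : set 'rV[R]_n)
    (f : 'rV[R]_n -> W) : V `<=` U -> smooth U f -> smooth V f.
Proof. by move=> VU sf k; exact: Ck_sub VU (sf k). Qed.

End SmoothTheory.

Section Manifold.
Context {R : realType}.

(* [coord] and [param] are total functions, but only their values on [dom] and
   [cod] matter. *)
Record chart (T : topologicalType) (n : nat) := Chart {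
  dom : set T;
  cod : set 'rV[R]_n;
  coord : T -> 'rV[R]_n;
  param : 'rV[R]_n -> T;
  open_dom : open dom;
  open_cod : open cod;
  coord_cod : forall x, dom x -> cod (coord x);
  param_dom : forall u, cod u -> dom (param u);
  coordK : forall x, dom x -> param (coord x) = x;
  paramK : forall u, cod u -> coord (param u) = u;
  chart_coord_continuous : forall x, dom x -> {for x, continuous coord};
  chart_param_continuous : forall u, cod u -> {for u, continuous param}
}.

Definition overlap (T : topologicalType) n (c d : chart T n) : set 'rV[R]_n :=
  [set u | cod c u /\ dom d (param c u)].

Definition transition (T : topologicalType) n (c d : chart T n) :
    'rV[R]_n -> 'rV[R]_n :=
  coord d \o param c.

Record manifold (n : nat) := Manifold {
  points :> topologicalType;
  hausdorff_points : hausdorff_space points;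
  second_countable_points : @second_countable points;
  atlas_index : Type;
  atlas : atlas_index -> chart points n;
  atlas_cover : forall x, exists i, dom (atlas i) x;
  atlas_smooth : forall i j,
    smooth (overlap (atlas i) (atlas j)) (transition (atlas i) (atlas j))
}.

(* A tensor field is given by its components in each chart.  Tangent vectors
   are row vectors [v] of components, on which a linear map with matrix [A]
   acts by [v *m A]; in particular the library's Jacobian ['J f u] satisfies
   [v *m 'J f u = 'd f u v]. *)
Definition tensor n (M : manifold n) :=
  atlas_index M -> 'rV[R]_n -> 'M[R]_n.

Definition smooth_tensor n (M : manifold n) (A : tensor M) : Prop :=
  forall i, smooth (cod (atlas i)) (A i).

(* Change of charts for bilinear forms, [(v, w) |-> v *m G *m w^T]. *)
Definition bilinear_tensor n (M : manifold n) (G : tensor M) : Prop :=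
  forall i j u, overlap (atlas i) (atlas j) u ->
    let t := transition (atlas i) (atlas j) in
    G i u = 'J t u *m G j (t u) *m ('J t u)^T.

(* Change of charts for fields of endomorphisms, [v |-> v *m A]. *)
Definition endomorphism_tensor n (M : manifold n) (A : tensor M) : Prop :=
  forall i j u, overlap (atlas i) (atlas j) u ->
    let t := transition (atlas i) (atlas j) in
    A i u *m 'J t u = 'J t u *m A j (t u).

Definition positive_definite n (G : 'M[R]_n) : Prop :=
  forall v : 'rV[R]_n, v != 0 -> 0 < (v *m G *m v^T) 0 0.

Record riemannian (n : nat) := Riemannian {
  riemannian_manifold :> manifold n;
  metric : tensor riemannian_manifold;
  metric_smooth : smooth_tensor metric;
  metric_tensor : bilinear_tensor metric;
  metric_sym : forall i u, cod (atlas i) u -> (metric i u)^T = metric i u;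
  metric_pos : forall i u, cod (atlas i) u -> positive_definite (metric i u)
}.

(* The Levi-Civita connection in a chart: the matrix of [nabla_(d_c)] acting on
   fields with constant components, i.e. [christoffel G u c a b] is
   Gamma^b_(c a) = 1/2 sum_l (d_c G_(a l) + d_a G_(c l) - d_l G_(c a)) G^(l b). *)
Definition christoffel n (G : 'rV[R]_n -> 'M[R]_n) (u : 'rV[R]_n) (c : 'I_n) :
    'M[R]_n :=
  2^-1 *: (\matrix_(a, l) ('D_('e_c) G u a l + 'D_('e_a) G u c l
                           - 'D_('e_l) G u c a) *m invmx (G u)).

(* The covariant derivative of an endomorphism field [J] along [d_c]. *)
Definition cov_deriv_endo n (G J : 'rV[R]_n -> 'M[R]_n) (u : 'rV[R]_n)
    (c : 'I_n) : 'M[R]_n :=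
  'D_('e_c) J u + J u *m christoffel G u c - christoffel G u c *m J u.

(* [n] is the real dimension; it is even, and the complex dimension is its
   half. *)
Record kahler (n : nat) := Kahler {
  kahler_riemannian :> riemannian n;
  cplx : tensor kahler_riemannian;
  cplx_smooth : smooth_tensor cplx;
  cplx_tensor : endomorphism_tensor cplx;
  cplx_square : forall i u, cod (atlas i) u -> cplx i u *m cplx i u = - 1%:M;
  cplx_isometry : forall i u, cod (atlas i) u ->
    cplx i u *m metric i u *m (cplx i u)^T = metric i u;
  cplx_parallel : forall i u c, cod (atlas i) u ->
    cov_deriv_endo (metric i) (cplx i) u c = 0
}.

End Manifold.

Arguments chart R T n : clear implicits.
Arguments manifold R n : clear implicits.
Arguments riemannian R n : clear implicits.
Arguments kahler R n : clear implicits.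

Section Product.
Context {R : realType}.

Lemma hausdorff_prod (S T : topologicalType) :
  hausdorff_space S -> hausdorff_space T -> hausdorff_space (S * T)%type.
Proof.
move=> hS hT [p1 p2] [q1 q2] pq; congr pair; [apply: hS|apply: hT] => A B pA qB.
  have [||[x1 x2] [/= [? _] [? _]]] := pq (A `*` setT) (B `*` setT); last by exists x1.
    by exists (A, setT) => //=; split => //; exact: filterT.
  by exists (B, setT) => //=; split => //; exact: filterT.
have [||[x1 x2] [/= [_ ?] [_ ?]]] := pq (setT `*` A) (setT `*` B);
    last by exists x2.
  by exists (setT, A) => //=; split => //; exact: filterT.
by exists (setT, B) => //=; split => //; exact: filterT.
Qed.

Lemma open_prod (S T : topologicalType) (A : set S) (B : set T) :
  open A -> open B -> open (A `*` B).
Proof.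
move=> oA oB; apply: (@openI _ (fst @^-1` A) (snd @^-1` B)).
  by apply: open_comp => // x _; exact: cvg_fst.
by apply: open_comp => // x _; exact: cvg_snd.
Qed.

Lemma second_countable_prod (S T : topologicalType) :
  @second_countable S -> @second_countable T -> @second_countable (S * T)%type.
Proof.
move=> [B cB [oB bB]] [C cC [oC bC]].
exists [set UV.1 `*` UV.2 | UV in B `*` C].
  exact: card_le_trans (card_image_le _ _) (countableX cB cC).
split => [_ [[U V] [/= BU CV] <-]|[x y] A].
  by apply: open_prod; [exact: oB|exact: oC].
move=> [[U V] /= [xU yV] UVA].
have [U' [BU' U'x] U'U] := bB x U xU; have [V' [CV' V'y] V'V] := bC y V yV.
exists (U' `*` V'); first by split => //; exists (U', V').
by move=> [a b] [/= U'a V'b]; apply: UVA; split; [exact: U'U|exact: V'V].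
Qed.

Section ProductChart.
Variables (S T : topologicalType) (p q : nat) (c : chart R S p) (d : chart R T q).

Let prod_cod := split_preimage (cod c) (cod d).
Let prod_coord (x : S * T) : 'rV[R]_(p + q) := row_mx (coord c x.1) (coord d x.2).
Let prod_param (u : 'rV[R]_(p + q)) := (param c (lsubmx u), param d (rsubmx u)).

Fact prod_open_dom : open (dom c `*` dom d).
Proof. by apply: open_prod; exact: open_dom. Qed.

Fact prod_open_cod : open prod_cod.
Proof. by apply: open_split_preimage; exact: open_cod. Qed.

Fact prod_coord_cod x : (dom c `*` dom d) x -> prod_cod (prod_coord x).
Proof.
by case=> ? ?; split; rewrite ?row_mxKl ?row_mxKr; exact: coord_cod.
Qed.

Fact prod_param_dom u : prod_cod u -> (dom c `*` dom d) (prod_param u).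
Proof. by case=> ? ?; split; exact: param_dom. Qed.

Fact prod_coordK x : (dom c `*` dom d) x -> prod_param (prod_coord x) = x.
Proof.
by case: x => x y [/= ? ?]; rewrite /prod_param row_mxKl row_mxKr !coordK.
Qed.

Fact prod_paramK u : prod_cod u -> prod_coord (prod_param u) = u.
Proof. by move=> [? ?]; rewrite /prod_coord /= !paramK// hsubmxK. Qed.

Fact prod_coord_continuous x :
  (dom c `*` dom d) x -> {for x, continuous prod_coord}.
Proof.
case: x => x y [/= cx dy].
rewrite (_ : prod_coord = fun z =>
  (mulmxr (row_mx 1%:M 0) \o (coord c \o fst)) z +
  (mulmxr (row_mx 0 1%:M) \o (coord d \o snd)) z); last first.
  by apply/funext => z; rewrite /prod_coord row_mx_mulE.
have cc : {for (x, y), continuous (coord c \o fst)}.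
  by apply: continuous_comp; [exact: cvg_fst|exact: chart_coord_continuous].
have cd : {for (x, y), continuous (coord d \o snd)}.
  by apply: continuous_comp; [exact: cvg_snd|exact: chart_coord_continuous].
apply: continuousD.
  exact: (continuous_comp cc (@linear_mx_continuous _ _ _ _ _ _)).
exact: (continuous_comp cd (@linear_mx_continuous _ _ _ _ _ _)).
Qed.

Fact prod_param_continuous u : prod_cod u -> {for u, continuous prod_param}.
Proof.
move=> [cu du].
have pc : {for u, continuous (param c \o lsubmx)}.
  apply: continuous_comp; first exact: continuous_lsubmx.
  exact: chart_param_continuous.
have pd : {for u, continuous (param d \o rsubmx)}.
  apply: continuous_comp; first exact: continuous_rsubmx.
  exact: chart_param_continuous.
exact: (cvg_pair pc pd).
Qed.

Definition chart_prod : chart R (S * T)%type (p + q) :=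
  Chart prod_open_dom prod_open_cod prod_coord_cod prod_param_dom prod_coordK
        prod_paramK prod_coord_continuous prod_param_continuous.

End ProductChart.

Lemma open_overlap (T : topologicalType) n (c d : chart R T n) :
  open (overlap c d).
Proof.
rewrite openE => u [cu du]; apply: filterI.
  by apply: open_nbhs_nbhs; split => //; exact: open_cod.
apply: (chart_param_continuous cu).
by apply: open_nbhs_nbhs; split => //; exact: open_dom.
Qed.

Lemma smooth_transition n (M : manifold R n) (i j : atlas_index M) u :
  overlap (atlas i) (atlas j) u ->
  differentiable (transition (atlas i) (atlas j)) u.
Proof. exact: smooth_differentiable (@atlas_smooth _ _ _ i j). Qed.

Section ProductManifold.
Variables (p q : nat) (M : manifold R p) (N : manifold R q).

Definition prod_atlas (i : atlas_index M * atlas_index N) :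
    chart R (M * N)%type (p + q) :=
  chart_prod (atlas i.1) (atlas i.2).

Fact prod_atlas_cover x : exists i, dom (prod_atlas i) x.
Proof.
have [i ix] := atlas_cover x.1; have [j jx] := atlas_cover x.2.
by exists (i, j).
Qed.

Lemma overlap_prod i j : overlap (prod_atlas i) (prod_atlas j) `<=`
  split_preimage (overlap (atlas i.1) (atlas j.1))
                 (overlap (atlas i.2) (atlas j.2)).
Proof. by move=> u [[? ?] [? ?]]. Qed.

Fact prod_atlas_smooth i j :
  smooth (overlap (prod_atlas i) (prod_atlas j))
         (transition (prod_atlas i) (prod_atlas j)).
Proof.
have sm := (smooth_row_mx (@open_overlap _ _ _ _) (@open_overlap _ _ _ _)
          (atlas_smooth i.1 j.1) (atlas_smooth i.2 j.2)).
exact: smooth_sub (@overlap_prod i j) sm.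
Qed.

Definition manifold_prod : manifold R (p + q) :=
  Manifold (hausdorff_prod (@hausdorff_points _ _ M) (@hausdorff_points _ _ N))
    (second_countable_prod (@second_countable_points _ _ M)
                           (@second_countable_points _ _ N))
    prod_atlas_cover prod_atlas_smooth.

Definition block_tensor (A : tensor M) (B : tensor N) : tensor manifold_prod :=
  fun i u => block_mx (A i.1 (lsubmx u)) 0 0 (B i.2 (rsubmx u)).

Lemma block_tensor_smooth A B :
  smooth_tensor A -> smooth_tensor B -> smooth_tensor (block_tensor A B).
Proof.
by move=> sA sB i; apply: smooth_block_diag => //; exact: open_cod.
Qed.

Lemma jacobian_prod i j u :
  overlap (prod_atlas i) (prod_atlas j) u ->
  'J (transition (prod_atlas i) (prod_atlas j)) u
  = block_mx ('J (transition (atlas i.1) (atlas j.1)) (lsubmx u)) 0 0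
             ('J (transition (atlas i.2) (atlas j.2)) (rsubmx u)).
Proof.
move=> /overlap_prod [h1 h2].
by rewrite -(jacobian_row_mx (smooth_transition h1) (smooth_transition h2)).
Qed.

Lemma block_tensor_bilinear A B :
  bilinear_tensor A -> bilinear_tensor B -> bilinear_tensor (block_tensor A B).
Proof.
move=> tA tB i j u o; have [h1 h2] := overlap_prod o.
rewrite /= jacobian_prod// /block_tensor (tA _ _ _ h1) (tB _ _ _ h2).
rewrite tr_block_mx !mulmx_block !trmx0 !(mulmx0, mul0mx, addr0, add0r).
by rewrite /transition /= row_mxKl row_mxKr.
Qed.

Lemma block_tensor_endomorphism A B :
  endomorphism_tensor A -> endomorphism_tensor B ->
  endomorphism_tensor (block_tensor A B).
Proof.
move=> tA tB i j u o; have [h1 h2] := overlap_prod o.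
rewrite /= jacobian_prod// /block_tensor.
rewrite !mulmx_block !(mulmx0, mul0mx, addr0, add0r).
by rewrite (tA _ _ _ h1) (tB _ _ _ h2) /transition /= row_mxKl row_mxKr.
Qed.

End ProductManifold.

Section ProductMetric.
Variables (p q : nat) (M : riemannian R p) (N : riemannian R q).

Let prod_metric : tensor (manifold_prod M N) :=
  block_tensor (@metric _ _ M) (@metric _ _ N).

Fact prod_metric_sym i u :
  cod (atlas i) u -> (prod_metric i u)^T = prod_metric i u.
Proof.
by move=> [? ?]; rewrite /prod_metric /block_tensor tr_block_mx !trmx0 !metric_sym.
Qed.

Fact prod_metric_pos i u :
  cod (atlas i) u -> positive_definite (prod_metric i u).
Proof.
move=> [cu du] v v0; rewrite /prod_metric /block_tensor -[v]hsubmxK.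
rewrite mul_row_block !mulmx0 addr0 add0r tr_row_mx mul_row_col mxE.
have posl (w : 'rV_p) : 0 <= (w *m metric i.1 (lsubmx u) *m w^T) 0 0.
  have [->|w0] := eqVneq w 0; first by rewrite !mul0mx mxE.
  exact/ltW/metric_pos.
have posr (w : 'rV_q) : 0 <= (w *m metric i.2 (rsubmx u) *m w^T) 0 0.
  have [->|w0] := eqVneq w 0; first by rewrite !mul0mx mxE.
  exact/ltW/metric_pos.
have [l0|l0] := eqVneq (lsubmx v) 0.
  rewrite ltr_wpDl//; apply: metric_pos => //; apply: contra_neq v0 => r0.
  by rewrite -[v]hsubmxK l0 r0 row_mx0.
by rewrite ltr_wpDr//; exact: metric_pos.
Qed.

Definition riemannian_prod : riemannian R (p + q) :=
  @Riemannian _ _ (manifold_prod M N) prod_metric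
    (block_tensor_smooth (@metric_smooth _ _ M) (@metric_smooth _ _ N))
    (block_tensor_bilinear (@metric_tensor _ _ M) (@metric_tensor _ _ N))
    prod_metric_sym prod_metric_pos.

End ProductMetric.

Definition koszul n (D : 'I_n -> 'M[R]_n) (c : 'I_n) : 'M[R]_n :=
  \matrix_(a, l) (D c a l + D a c l - D l c a).

Section KoszulBlock.
Variables (p q : nat) (D : 'I_p -> 'M[R]_p) (E : 'I_q -> 'M[R]_q).
Variable F : 'I_(p + q) -> 'M[R]_(p + q).
Hypothesis Fl : forall a, F (lshift q a) = block_mx (D a) 0 0 0.
Hypothesis Fr : forall b, F (rshift p b) = block_mx 0 0 0 (E b).

Lemma koszul_lshift c : koszul F (lshift q c) = block_mx (koszul D c) 0 0 0.
Proof.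
apply/matrixP => a l; rewrite mxE Fl.
have := fintype.splitK a; case: (fintype.split a) => a' /= <-;
have := fintype.splitK l; case: (fintype.split l) => l' /= <-;
by rewrite !(Fl, Fr) ?block_mxEul ?block_mxEur ?block_mxEdl ?block_mxEdr !mxE
  ?addr0 ?subr0.
Qed.

Lemma koszul_rshift c : koszul F (rshift p c) = block_mx 0 0 0 (koszul E c).
Proof.
apply/matrixP => a l; rewrite mxE Fr.
have := fintype.splitK a; case: (fintype.split a) => a' /= <-;
have := fintype.splitK l; case: (fintype.split l) => l' /= <-;
by rewrite !(Fl, Fr) ?block_mxEul ?block_mxEur ?block_mxEdl ?block_mxEdr !mxE
  ?addr0 ?subr0.
Qed.

End KoszulBlock.

Section ProductChristoffel.
Variables (p q : nat) (G : 'rV[R]_p -> 'M[R]_p) (H : 'rV[R]_q -> 'M[R]_q).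
Variable (u : 'rV[R]_(p + q)).
Hypotheses (dG : differentiable G (lsubmx u)) (dH : differentiable H (rsubmx u)).
Hypotheses (uG : G (lsubmx u) \in unitmx) (uH : H (rsubmx u) \in unitmx).

Let GH (u : 'rV[R]_(p + q)) := block_mx (G (lsubmx u)) 0 0 (H (rsubmx u)).

Lemma derive_block_lshift c :
  'D_('e_(lshift q c)) GH u = block_mx ('D_('e_c) G (lsubmx u)) 0 0 0.
Proof. by rewrite (derive_block_diag _ dG dH) lsubmx_e_lshift rsubmx_e_lshift derive0. Qed.

Lemma derive_block_rshift c :
  'D_('e_(rshift p c)) GH u = block_mx 0 0 0 ('D_('e_c) H (rsubmx u)).
Proof. by rewrite (derive_block_diag _ dG dH) lsubmx_e_rshift rsubmx_e_rshift derive0. Qed.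

Lemma invmx_GH : invmx (GH u) =
  block_mx (invmx (G (lsubmx u))) 0 0 (invmx (H (rsubmx u))).
Proof. by rewrite /GH invmx_block_diag// unitmxE det_ublock unitrM -!unitmxE uG. Qed.

Lemma christoffel_lshift c : christoffel GH u (lshift q c)
  = block_mx (christoffel G (lsubmx u) c) 0 0 0.
Proof.
rewrite [in LHS]/christoffel invmx_GH.
rewrite -[\matrix_(a, l) _]/(koszul (fun a => 'D_('e_a) GH u) (lshift q c)).
rewrite (koszul_lshift derive_block_lshift derive_block_rshift).
by rewrite mulmx_block !(mulmx0, mul0mx, addr0) scale_block_mx !scaler0.
Qed.

Lemma christoffel_rshift c : christoffel GH u (rshift p c)
  = block_mx 0 0 0 (christoffel H (rsubmx u) c).
Proof.
rewrite [in LHS]/christoffel invmx_GH.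
rewrite -[\matrix_(a, l) _]/(koszul (fun a => 'D_('e_a) GH u) (rshift p c)).
rewrite (koszul_rshift derive_block_lshift derive_block_rshift).
by rewrite mulmx_block !(mulmx0, mul0mx, add0r) scale_block_mx !scaler0.
Qed.

End ProductChristoffel.

Lemma positive_definite_unitmx n (G : 'M[R]_n) :
  positive_definite G -> G \in unitmx.
Proof.
move=> pG; rewrite -row_free_unit -kermx_eq0; apply/eqP/row_matrixP => i.
rewrite row0; apply/eqP/negP => /negP w0; have := pG _ w0.
by rewrite -row_mul mulmx_ker row0 mul0mx mxE ltxx.
Qed.

Lemma metric_unitmx n (M : riemannian R n) (i : atlas_index M) u :
  cod (atlas i) u -> metric i u \in unitmx.
Proof. by move=> /metric_pos/positive_definite_unitmx. Qed.

Section ProductKahler.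
Variables (p q : nat) (M : kahler R p) (N : kahler R q).

Let prod_cplx : tensor (riemannian_prod M N) :=
  block_tensor (@cplx _ _ M) (@cplx _ _ N).

Fact prod_cplx_square i u :
  cod (atlas i) u -> prod_cplx i u *m prod_cplx i u = - 1%:M.
Proof.
move=> [cu du]; rewrite /prod_cplx /block_tensor mulmx_block.
rewrite !(mulmx0, mul0mx, addr0, add0r) !cplx_square//.
by rewrite [in RHS]scalar_mx_block opp_block_mx !oppr0.
Qed.

Fact prod_cplx_isometry i u : cod (atlas i) u ->
  prod_cplx i u *m metric i u *m (prod_cplx i u)^T = metric i u.
Proof.
move=> [cu du]; rewrite /prod_cplx /= /block_tensor tr_block_mx !mulmx_block.
by rewrite !trmx0 !(mulmx0, mul0mx, addr0, add0r) !cplx_isometry.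
Qed.

Fact prod_cplx_parallel i u c : cod (atlas i) u ->
  cov_deriv_endo (metric i) (prod_cplx i) u c = 0.
Proof.
move=> [cu du].
have dG := smooth_differentiable (@metric_smooth _ _ M i.1) cu.
have dH := smooth_differentiable (@metric_smooth _ _ N i.2) du.
have dI := smooth_differentiable (@cplx_smooth _ _ M i.1) cu.
have dJ := smooth_differentiable (@cplx_smooth _ _ N i.2) du.
have uG := metric_unitmx cu; have uH := metric_unitmx du.
rewrite /cov_deriv_endo /prod_cplx /=.
have := fintype.splitK c; case: (fintype.split c) => c' /= <-.
  rewrite (derive_block_lshift dI dJ) (christoffel_lshift dG dH uG uH).
  have := cplx_parallel c' cu; rewrite /cov_deriv_endo => nJ.
  rewrite /block_tensor !mulmx_block !(mulmx0, mul0mx, addr0) opp_block_mx.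
  by rewrite !add_block_mx !(addr0, oppr0) nJ block_mx0.
rewrite (derive_block_rshift dI dJ) (christoffel_rshift dG dH uG uH).
have := cplx_parallel c' du; rewrite /cov_deriv_endo => nJ.
rewrite /block_tensor !mulmx_block !(mulmx0, mul0mx, add0r) opp_block_mx.
by rewrite !add_block_mx !(addr0, oppr0) nJ block_mx0.
Qed.

Definition kahler_prod : kahler R (p + q) :=
  @Kahler _ _ (riemannian_prod M N) prod_cplx
    (block_tensor_smooth (@cplx_smooth _ _ M) (@cplx_smooth _ _ N))
    (block_tensor_endomorphism (@cplx_tensor _ _ M) (@cplx_tensor _ _ N))
    prod_cplx_square prod_cplx_isometry prod_cplx_parallel.

End ProductKahler.

(* The almost product structure [P - Q], where [P] and [Q] are the projections
   of the tangent bundle of the product onto those of its factors. *)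
Definition proj_left p q (M : manifold R p) (N : manifold R q) :
    tensor (manifold_prod M N) := fun _ _ => block_mx 1%:M 0 0 0.

Definition proj_right p q (M : manifold R p) (N : manifold R q) :
    tensor (manifold_prod M N) := fun _ _ => block_mx 0 0 0 1%:M.

Definition almost_product p q (M : manifold R p) (N : manifold R q) :
    tensor (manifold_prod M N) := fun i u => proj_left i u - proj_right i u.

End Product.

Arguments almost_product {R p q} M N.

Section Submanifold.
Context {R : realType}.

(* An immersed submanifold; it need not be embedded. *)
Record submanifold (k n : nat) (B : manifold R n) := Submanifold {
  submanifold_manifold :> manifold R k;
  incl : submanifold_manifold -> B;
  incl_continuous : continuous incl;
  incl_smooth : forall i j,
    smooth [set u | cod (atlas i) u /\ dom (atlas j) (incl (param (atlas i) u))]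
           (coord (atlas j) \o incl \o param (atlas i));
  incl_immersion : forall i j x, dom (atlas i) x -> dom (atlas j) (incl x) ->
    row_free ('J (coord (atlas j) \o incl \o param (atlas i))
                 (coord (atlas i) x))
}.

Definition local_incl k n (B : manifold R n) (S : submanifold k B)
    (i : atlas_index S) (j : atlas_index B) : 'rV[R]_k -> 'rV[R]_n :=
  coord (atlas j) \o incl (s := S) \o param (atlas i).

Definition chart_pair k n (B : manifold R n) (S : submanifold k B)
    (i : atlas_index S) (j : atlas_index B) (x : S) : Prop :=
  dom (atlas i) x /\ dom (atlas j) (incl x).

(* The row space of [tangent_mx i j x] is the tangent space of the submanifold
   at [x], inside the tangent space of [B] at [incl x], in the chart [j]. *)
Definition tangent_mx k n (B : manifold R n) (S : submanifold k B)
    (i : atlas_index S) (j : atlas_index B) (x : S) : 'M[R]_(k, n) :=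
  'J (local_incl i j) (coord (atlas i) x).

(* The row space of [normal_mx i j x] is the normal space: [w] belongs to it
   iff [w *m G *m v^T = 0] for all tangent [v]. *)
Definition normal_mx k n (B : riemannian R n) (S : submanifold k B)
    (i : atlas_index S) (j : atlas_index B) (x : S) : 'M[R]_n :=
  kermx (metric j (coord (atlas j) (incl x)) *m (tangent_mx i j x)^T).

Definition anti_invariant k n (B : riemannian R n) (S : submanifold k B)
    (A : tensor B) : Prop :=
  forall i j (x : S), chart_pair i j x ->
    (tangent_mx i j x *m A j (coord (atlas j) (incl x)) <= normal_mx i j x)%MS.

Definition lagrangian k n (B : kahler R n) (S : submanifold k B) : Prop :=
  forall i j (x : S), chart_pair i j x ->
    (tangent_mx i j x *m cplx j (coord (atlas j) (incl x)) :=: normal_mx i j x)%MS.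

(* The covariant derivative in direction [X] of a field [V] along the map [f],
   for the Levi-Civita connection of the metric [G]. *)
Definition cov_deriv_along k n (G : 'rV[R]_n -> 'M[R]_n)
    (f V : 'rV[R]_k -> 'rV[R]_n) (u X : 'rV[R]_k) : 'rV[R]_n :=
  'D_X V u + V u *m (\sum_c ('D_X f u) 0 c *: christoffel G (f u) c).

(* Gauss formula: the normal component of the ambient covariant derivative
   along [X] of the tangent field ['D_Y f], where [Y] is extended with constant
   components in the chart [i]. *)
Definition second_fundamental_form k n (B : riemannian R n)
    (S : submanifold k B) (i : atlas_index S) (j : atlas_index B) (x : S)
    (X Y : 'rV[R]_k) : 'rV[R]_n :=
  cov_deriv_along (metric j) (local_incl i j) ('D_Y (local_incl i j))
                  (coord (atlas i) x) X
    *m proj_mx (normal_mx i j x) <<tangent_mx i j x>>%MS.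

Definition totally_geodesic k n (B : riemannian R n) (S : submanifold k B) :
    Prop :=
  forall i j (x : S) (X Y : 'rV[R]_k), chart_pair i j x ->
    second_fundamental_form i j x X Y = 0.

End Submanifold.

Arguments submanifold {R} k {n} B.

(* Main.v *)
(* Write h for the second fundamental form and B(X, Y, Z) = g(h(X, Y), F Z).
   B is symmetric in X, Y.  Since F is parallel, differentiating g(F Y, Z) = 0
   along X shows that B is skew in Y, Z; a trilinear form with both symmetries
   vanishes.  As M is Lagrangian, the dimension count turns F(TM) into the whole
   normal bundle, so that h = 0.  The complex structure enters only through this
   count. *)
Require Import Defs.
From mathcomp Require Import all_boot all_order all_algebra.
From mathcomp Require Import all_classical all_reals all_analysis.
From mathcomp Require Import ring lra.

Set Implicit Arguments.
Unset Strict Implicit.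
Unset Printing Implicit Defensive.

Import Order.TTheory GRing.Theory Num.Theory.
Import numFieldNormedType.Exports.
Local Open Scope classical_set_scope.
Local Open Scope ring_scope.
Import Defs.

(** * Symmetry of second derivatives, by the mean value theorem *)

(** The difference quotients along the line are those of the directional derivative, so one-variable
    calculus applies to [g] along [v]. *)
Lemma is_derive_line (R : realType) (V W : normedModType R) (g : V -> W)
    (v w : V) (s : R) :
  derivable g (s *: v + w) v ->
  is_derive s 1 (fun r : R => g (r *: v + w)) ('D_v g (s *: v + w)).
Proof.
have E : (fun h : R => h^-1 *: (((fun r : R => g (r *: v + w)) \o shift s) (h *: 1)
    - g (s *: v + w))) =
  (fun h : R => h^-1 *: ((g \o shift (s *: v + w)) (h *: v) - g (s *: v + w))).
  by apply/funext => h /=; rewrite [h *: 1]mulr1 scalerDl addrA.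
by move=> dg; split; rewrite /derivable /derive E.
Qed.

(* By the mean value theorem along [X], the second difference is [t] times a
   difference of values of ['D_X g]; it is also symmetric in [X] and [Y]. *)
Lemma second_difference_cvg (R : realType) (V : normedModType R) (g : V -> R)
    (u X Y : V) :
  (\forall v \near u, derivable g v X) -> differentiable ('D_X g) u ->
  (fun t : R => (t ^+ 2)^-1 * (g (t *: X + (t *: Y + u)) - g (t *: X + u)
                               - g (t *: Y + u) + g u)) @ 0^'+
    --> 'D_Y ('D_X g) u.
Proof.
(* For [0 <= s <= t], both [s *: X + t *: Y] and [s *: X] have norm at most [t * M]; the summand 1
   keeps [M] positive when [X] and [Y] vanish. *)
move=> dg ddg; set M := `|X| + `|Y| + 1.
have X0 := normr_ge0 X; have Y0 := normr_ge0 Y.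
have M0 : 0 < M by rewrite /M; lra.
apply/cvgrPdist_le => e e0; rewrite (deriveE _ ddg); set A := 'd _ u.
have e'0 : 0 < e / (2 * M) by rewrite divr_gt0// mulr_gt0.
have /eqaddoP/(_ _ e'0) := diff_locally ddg.
move: dg; rewrite (near_shift 0 u) subr0 => dg /(filterI dg).
move=> /nbhs_ballP[r /= r0 rB].
have hyp h : `|h| < r -> derivable g (h + u) X /\
    `|'D_X g (h + u) - ('D_X g u + A h)| <= e / (2 * M) * `|h|.
  by move=> hr; have := rB h; rewrite -ball_normE /= sub0r normrN; exact.
near=> t.
have t0 : 0 < t by near: t; exact: nbhs_right_gt.
have tr : t * M < r.
  by rewrite -ltr_pdivlMr//; near: t; apply: nbhs_right_lt; rewrite divr_gt0.
have small s : 0 <= s <= t -> `|s *: X + t *: Y| <= t * M /\ `|s *: X| <= t * M.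
  move=> /andP[s0 st].
  have sX : `|s *: X| <= t * `|X| by rewrite normrZ ger0_norm// ler_wpM2r.
  have tY : `|t *: Y| = t * `|Y| by rewrite normrZ gtr0_norm.
  have tY0 : 0 <= t * `|Y| by rewrite mulr_ge0// ltW.
  by split; rewrite ?(le_trans (ler_normD _ _))// /M; lra.
pose phi s := g (s *: X + (t *: Y + u)) - g (s *: X + u).
pose df s := 'D_X g (s *: X + (t *: Y + u)) - 'D_X g (s *: X + u).
have D s : 0 <= s <= t -> is_derive s 1 phi (df s).
  move=> st; have [b1 b2] := small s st.
  have d1 : derivable g (s *: X + (t *: Y + u)) X.
    by rewrite addrA; exact: (hyp _ (le_lt_trans b1 tr)).1.
  have d2 := (hyp _ (le_lt_trans b2 tr)).1.
  exact: is_deriveB (is_derive_line d1) (is_derive_line d2).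
have [||c /itvP ict] := MVT (f := phi) (df := df) t0.
- by move=> s /itvP ist; apply: D; rewrite !ist.
- apply: derivable_within_continuous => s /itvP ist.
  by have [|+ _] := D s; rewrite ?ist.
rewrite /phi subr0 !scale0r !add0r => E.
have ct : 0 <= c <= t by rewrite !ict.
have [b1 b2] := small c ct.
have [_ h1] := hyp _ (le_lt_trans b1 tr).
have [_ h2] := hyp _ (le_lt_trans b2 tr).
have -> : g (t *: X + (t *: Y + u)) - g (t *: X + u) - g (t *: Y + u) + g u =
    df c * t by rewrite -E; ring.
have -> : (t ^+ 2)^-1 * (df c * t) = t^-1 * df c.
  by field; rewrite gt_eqF.
rewrite -(ler_pM2l t0) -{1}(gtr0_norm t0) -normrM mulrBr mulrA divff ?gt_eqF//.
rewrite mul1r -[t * A Y]/(t *: A Y) -linearZ.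
(* Written this way, the limit is matched with the first-order expansions of ['D_X g] at the two
   displacements [c *: X + t *: Y] and [c *: X]. Each costs at most
   [e / (2 * M) * (t * M) = t * e / 2]. *)
have -> : A (t *: Y) = A (c *: X + t *: Y) - A (c *: X) by rewrite linearD addrC addKr.
rewrite /df addrA; move: h1 h2.
set a1 := A _; set a2 := A _; set d1 := 'D_X g _; set d2 := 'D_X g _; set d := 'D_X g _.
have eM k : k <= t * M -> e / (2 * M) * k <= t * e / 2.
  have <- : e / (2 * M) * (t * M) = t * e / 2 by field; rewrite gt_eqF.
  by rewrite ler_pM2l.
move=> /le_trans /(_ (eM _ b1)); rewrite ler_norml => /andP[? ?].
move=> /le_trans /(_ (eM _ b2)); rewrite ler_norml => /andP[? ?].
rewrite ler_norml; apply/andP; split; lra.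
Unshelve. all: by end_near. Qed.

(** Entrywise, both mixed derivatives are limits of one second difference quotient, which is
    unchanged when [X] and [Y] are swapped; limits are unique. *)
Lemma derive_comm (R : realType) (V : normedModType R) p q (f : V -> 'M[R]_(p, q))
    (u X Y : V) :
  (\forall v \near u, derivable f v X) -> (\forall v \near u, derivable f v Y) ->
  differentiable ('D_X f) u -> differentiable ('D_Y f) u ->
  'D_X ('D_Y f) u = 'D_Y ('D_X f) u.
Proof.
move=> dX dY ddX ddY; apply/matrixP => i j.
have coordE Z : (\forall v \near u, derivable f v Z) ->
    \near u, 'D_Z f u i j = 'D_Z (fun v => f v i j) u.
  by apply: filterS => v dv; rewrite derive_mx// mxE.
have coord_derivable Z : (\forall v \near u, derivable f v Z) ->
    \forall v \near u, derivable (fun v => f v i j) v Z.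
  by apply: filterS => v /derivable_mxP.
have coord_differentiable Z : (\forall v \near u, derivable f v Z) ->
    differentiable ('D_Z f) u -> differentiable ('D_Z (fun v => f v i j)) u.
  move=> dZ ddZ; apply: near_eq_differentiable (coordE _ dZ) _.
  exact: differentiable_comp ddZ (differentiable_coord _ i j).
have coord2E Z Z' : (\forall v \near u, derivable f v Z) ->
    differentiable ('D_Z f) u ->
    'D_Z' ('D_Z f) u i j = 'D_Z' ('D_Z (fun v => f v i j)) u.
  move=> dZ ddZ; rewrite derive_mx ?mxE; last exact: diff_derivable.
  exact: near_eq_derive (coordE _ dZ).
have EY := coord2E Y X dY ddY; have EX := coord2E X Y dX ddX.
refine (etrans EY (etrans _ (esym EX))).
have cY := coord_derivable _ dY; have cX := coord_derivable _ dX.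
have cvgX := second_difference_cvg (Y := Y) cX (coord_differentiable _ dX ddX).
have := second_difference_cvg (Y := X) cY (coord_differentiable _ dY ddY).
move=> cvgY; apply: norm_cvg_unique cvgY _.
apply: cvg_trans cvgX; apply: near_eq_cvg; near=> t.
by rewrite !(addrCA (t *: X)); ring.
Unshelve. all: by end_near. Qed.

(** * Product and transposition rules for matrix-valued functions *)

Section MatrixDerivative.
Context {R : realType} {V : normedModType R}.

Lemma derivable_mulmx p q r (A : V -> 'M[R]_(p, q)) (B : V -> 'M[R]_(q, r)) u v :
  derivable A u v -> derivable B u v -> derivable (fun x => A x *m B x) u v.
Proof.
move=> /derivable_mxP dA /derivable_mxP dB; apply/derivable_mxP => i j.
rewrite (_ : (fun x => _) = \sum_l ((fun x => A x i l) * (fun x => B x l j))).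
  by apply: derivable_sum => l; exact: derivableM.
by apply/funext => x; rewrite mxE fct_sumE.
Qed.

Lemma derive_mulmx p q r (A : V -> 'M[R]_(p, q)) (B : V -> 'M[R]_(q, r)) u v :
  derivable A u v -> derivable B u v ->
  'D_v (fun x => A x *m B x) u = 'D_v A u *m B u + A u *m 'D_v B u.
Proof.
move=> dA dB; have dAB := derivable_mulmx dA dB.
rewrite (derive_mx dA) (derive_mx dB) (derive_mx dAB).
move/derivable_mxP in dA; move/derivable_mxP in dB.
apply/matrixP => i j; rewrite !mxE -big_split/=.
rewrite (_ : (fun x => _) = \sum_l ((fun x => A x i l) * (fun x => B x l j))).
  rewrite derive_sum; last by move=> l; exact: derivableM.
  apply: eq_bigr => l _; rewrite (deriveM (dA i l) (dB l j)) !mxE addrC.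
  by congr (_ + _); rewrite [LHS]mulrC.
by apply/funext => x; rewrite mxE fct_sumE.
Qed.

Lemma derivable_trmx p q (A : V -> 'M[R]_(p, q)) u v :
  derivable A u v -> derivable (fun x => (A x)^T) u v.
Proof.
move=> /derivable_mxP dA; apply/derivable_mxP => i j.
by under eq_fun do rewrite mxE; exact: dA.
Qed.

Lemma derive_trmx p q (A : V -> 'M[R]_(p, q)) u v :
  derivable A u v -> 'D_v (fun x => (A x)^T) u = ('D_v A u)^T.
Proof.
move=> dA; rewrite (derive_mx dA) (derive_mx (derivable_trmx dA)).
by apply/matrixP => i j; rewrite !mxE; under eq_fun do rewrite mxE.
Qed.

End MatrixDerivative.

(** * The Levi-Civita connection: torsion-freeness and metric compatibility *)

Section Koszul.
Variables (R : realType) (n : nat) (D : 'I_n -> 'M[R]_n).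
Hypothesis D_sym : forall c, (D c)^T = D c.

Let D_symE c a b : D c a b = D c b a.
Proof. by rewrite -[in LHS]D_sym mxE. Qed.

(** With [D c] the derivative of the metric along the c-th coordinate, this is the symmetry of the
    Christoffel symbols in their lower indices, the source of torsion-freeness. *)
Lemma row_koszul a c : row a (koszul D c) = row c (koszul D a).
Proof. by apply/rowP => l; rewrite !mxE (D_symE l a) [D c a l + _]addrC. Qed.

(** The part [D a c l - D l c a] is skew in [a] and [l] and cancels against its transpose; what
    remains yields metric compatibility. *)
Lemma koszul_add_trmx c : koszul D c + (koszul D c)^T = D c *+ 2.
Proof. by rewrite mulr2n; apply/matrixP => a l; rewrite !mxE (D_symE c l a); ring. Qed.

End Koszul.

(** The connection form evaluated on [w]: in a chart, a field [v] has covariant derivative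
    ['D_w v y + v y *m connection_mx G y w] along [w]. *)
Definition connection_mx (R : realType) n (G : 'rV[R]_n -> 'M[R]_n)
    (y w : 'rV[R]_n) : 'M[R]_n :=
  \sum_c w 0 c *: christoffel G y c.

Section Christoffel.
Context {R : realType} {n : nat}.
Variables (G : 'rV[R]_n -> 'M[R]_n) (y : 'rV[R]_n).
Hypothesis dG : differentiable G y.
Hypothesis G_sym : \near y, (G y)^T = G y.
Hypothesis G_unit : G y \in unitmx.

Local Notation Gamma := (connection_mx G y).

Lemma derive_row_sum (W : normedModType R) (f : 'rV[R]_n -> W) (w : 'rV[R]_n) :
  differentiable f y -> 'D_w f y = \sum_c w 0 c *: 'D_('e_c) f y.
Proof.
move=> df; rewrite (deriveE _ df) {1}[w]row_sum_delta linear_sum.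
by apply: eq_bigr => c _; rewrite linearZ -deriveE.
Qed.

Lemma derive_metric_sym v : ('D_v G y)^T = 'D_v G y.
Proof.
rewrite -derive_trmx; last exact: diff_derivable.
exact: near_eq_derive.
Qed.

Lemma christoffel_koszul c :
  christoffel G y c = 2^-1 *: (koszul (fun a => 'D_('e_a) G y) c *m invmx (G y)).
Proof. by []. Qed.

Lemma row_christoffel a c : row a (christoffel G y c) = row c (christoffel G y a).
Proof.
rewrite !christoffel_koszul !linearZ /= !row_mul; congr (_ *: (_ *m _)).
by apply: row_koszul => l; exact: derive_metric_sym.
Qed.

Lemma christoffel_torsion_free (v w : 'rV[R]_n) : v *m Gamma w = w *m Gamma v.
Proof.
have E (a b : 'rV[R]_n) : a *m Gamma b =
    \sum_i \sum_c (a 0 i * b 0 c) *: row i (christoffel G y c).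
  rewrite mulmx_sum_row; apply: eq_bigr => i _; rewrite linear_sum scaler_sumr.
  by apply: eq_bigr => c _; rewrite /= linearZ scalerA.
rewrite !E exchange_big /=; apply: eq_bigr => c _; apply: eq_bigr => i _.
by rewrite row_christoffel mulrC.
Qed.

Lemma christoffel_metric w : Gamma w *m G y + (Gamma w *m G y)^T = 'D_w G y.
Proof.
have E c : christoffel G y c *m G y + (christoffel G y c *m G y)^T = 'D_('e_c) G y.
  rewrite christoffel_koszul -scalemxAl mulmxKV// linearZ /= -scalerDr.
  rewrite koszul_add_trmx => [|l]; last exact: derive_metric_sym.
  by rewrite -[X in _ *: X]scaler_nat scalerA mulVf ?scale1r// pnatr_eq0.
rewrite derive_row_sum// mulmx_suml linear_sum -big_split; apply: eq_bigr => c _.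
by rewrite -scalemxAl linearZ /= -scalerDr E.
Qed.

End Christoffel.

(** * Algebra of the two symmetries *)

(** Alternating the two transpositions three times each returns to the original order of the
    arguments, but with three sign changes. *)
Lemma sym12_skew23_eq0 (R : numDomainType) (T : Type) (B : T -> T -> T -> R) :
  (forall x y z, B x y z = B y x z) -> (forall x y z, B x y z = - B x z y) ->
  forall x y z, B x y z = 0.
Proof.
move=> sym skew x y z.
have E : B x y z = - B x y z.
  rewrite [LHS]skew [in LHS]sym [in LHS]skew opprK.
  by rewrite [LHS]sym [LHS]skew [in LHS]sym.
apply/eqP; rewrite -[_ == 0]/((2 == 0)%N || (B x y z == 0)) -mulrn_eq0.
by rewrite mulr2n {2}E subrr.
Qed.

(** The pointwise content of differentiating g(F y, z) = 0: [y'] and [z'] are the derivatives of [y]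
    and [z], [Gm] is the connection form, and [Gm *m G + (Gm *m G)^T] is the derivative of the
    metric. Commutation with [Gm] lets covariant derivatives pass through [P]. *)
Lemma bilinear_derivative_skew (R : comPzRingType) n (y z y' z' : 'rV[R]_n)
    (P G Gm : 'M[R]_n) :
  G^T = G -> P *m G = G *m P^T -> P *m Gm = Gm *m P ->
  (y' *m P *m G + y *m P *m (Gm *m G + (Gm *m G)^T)) *m z^T
    + y *m P *m G *m z'^T = 0 ->
  (y' + y *m Gm) *m P *m G *m z^T = - ((z' + z *m Gm) *m P *m G *m y^T).
Proof.
move=> sG PG PGm E; apply/eqP; rewrite -addr_eq0.
have tr11 (A : 'M[R]_1) : A^T = A by rewrite [A]mx11_scalar tr_scalar_mx.
have yGm : y *m P *m (Gm *m G) = y *m Gm *m P *m G.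
  by rewrite mulmxA -[y *m P *m Gm]mulmxA PGm !mulmxA.
(* Self-adjointness of [P], combined with transposing a one-by-one matrix. *)
have -> : (z' + z *m Gm) *m P *m G *m y^T = y *m P *m G *m (z' + z *m Gm)^T.
  by rewrite -[LHS]tr11 !trmx_mul trmxK sG !mulmxA -[y *m G *m P^T]mulmxA -PG mulmxA.
rewrite -[X in _ == X]E trmx_mul sG [in X in _ == X]mulmxDr yGm linearD /= trmx_mul.
rewrite !(mulmxDl, mulmxDr) !mulmxA -!addrA.
by rewrite [X in _ + (_ + X)]addrC.
Qed.

(** * Immersions anti-invariant under a parallel self-adjoint structure *)

Section Immersion.
Context {R : realType} {k n : nat}.
Variables (f : 'rV[R]_k -> 'rV[R]_n) (u : 'rV[R]_k).
Variables (G : 'rV[R]_n -> 'M[R]_n) (P : 'M[R]_n).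
Hypothesis df : \near u, differentiable f u.
Hypothesis ddf : forall Y, differentiable ('D_Y f) u.
Hypothesis dG : differentiable G (f u).
Hypothesis G_sym : \forall y \near f u, (G y)^T = G y.
Hypothesis G_unit : G (f u) \in unitmx.
Hypothesis P_christoffel :
  forall c, P *m christoffel G (f u) c = christoffel G (f u) c *m P.
Hypothesis P_metric : P *m G (f u) = G (f u) *m P^T.
Hypothesis P_anti_invariant : forall Y Z,
  \near u, 'D_Y f u *m P *m G (f u) *m ('D_Z f u)^T = 0.

Local Notation nabla X Y := (cov_deriv_along G f ('D_Y f) u X).

Lemma cov_deriv_alongE X Y :
  nabla X Y = 'D_X ('D_Y f) u + 'D_Y f u *m connection_mx G (f u) ('D_X f u).
Proof. by []. Qed.

(** Second derivatives of [f] commute, and the connection term is symmetric because torsion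
    vanishes. *)
Lemma cov_deriv_along_sym X Y : nabla X Y = nabla Y X.
Proof.
have dfZ Z : \forall v \near u, derivable f v Z.
  by apply: filterS df => v /diff_derivable.
have E1 := derive_comm (dfZ X) (dfZ Y) (ddf X) (ddf Y).
have E2 := christoffel_torsion_free dG G_sym ('D_Y f u) ('D_X f u).
rewrite /cov_deriv_along.
exact: (f_equal2 +%R E1 E2).
Qed.

Lemma P_connection w :
  P *m connection_mx G (f u) w = connection_mx G (f u) w *m P.
Proof.
rewrite mulmx_sumr mulmx_suml; apply: eq_bigr => c _.
by rewrite -scalemxAl -scalemxAr P_christoffel.
Qed.

Lemma derive_metric_along X :
  'D_X (G \o f) u = 'D_('D_X f u) G (f u).
Proof.
have dfu := nbhs_singleton df.
rewrite (deriveE _ (differentiable_comp dfu dG)) (deriveE _ dG) (deriveE _ dfu).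
by rewrite (diff_comp dfu dG).
Qed.

(** Anti-invariance holds on a neighbourhood, so it may be differentiated along [X]. As [P] has
    constant components, commuting with the Christoffel matrices says that it is parallel. *)
Lemma cov_deriv_along_skew X Y Z :
  nabla X Y *m P *m G (f u) *m ('D_Z f u)^T
  = - (nabla X Z *m P *m G (f u) *m ('D_Y f u)^T).
Proof.
have dfu := nbhs_singleton df.
have d1 W : derivable ('D_W f) u X by exact: diff_derivable.
have d2 : derivable (fun x => 'D_Y f x *m P) u X.
  exact: derivable_mulmx (d1 Y) (derivable_cst P u X).
have d3 : derivable (G \o f) u X.
  exact/diff_derivable/(differentiable_comp dfu dG).
have d4 := derivable_mulmx d2 d3; have d5 := derivable_trmx (d1 Z).
have : 'D_X (fun x => 'D_Y f x *m P *m (G \o f) x *m ('D_Z f x)^T) u = 0.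
  by rewrite (near_eq_derive _ (P_anti_invariant Y Z)) derive_cst.
rewrite (derive_mulmx d4 d5) (derive_mulmx d2 d3).
rewrite (derive_mulmx (d1 Y) (derivable_cst P u X)) derive_cst mulmx0 addr0.
rewrite (derive_trmx (d1 Z)) derive_metric_along.
rewrite -(christoffel_metric dG G_sym G_unit) !cov_deriv_alongE.
set w := 'D_X f u; set Gm := connection_mx _ _ _; rewrite /=.
have sG : (G (f u))^T = G (f u) := nbhs_singleton G_sym.
exact: bilinear_derivative_skew (P_connection w).
Qed.

(** The form [B] uses the full covariant derivative instead of its normal part: tangential parts
    contribute nothing to it, by anti-invariance. *)
Lemma second_derivative_orthogonal X Y Z :
  nabla X Y *m P *m G (f u) *m ('D_Z f u)^T = 0.
Proof.
apply/matrixP => i j; rewrite !ord1 [RHS]mxE.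
pose B X Y Z := (nabla X Y *m P *m G (f u) *m ('D_Z f u)^T) 0 0.
apply: (@sym12_skew23_eq0 _ _ B) => {}X {}Y {}Z.
  exact: (congr1 (fun w => (w *m P *m G (f u) *m ('D_Z f u)^T) 0 0)
                 (cov_deriv_along_sym X Y)).
have oppE (A : 'M[R]_1) : (- A) 0 0 = - A 0 0 by rewrite mxE.
exact: etrans (congr1 (fun A : 'M[R]_1 => A 0 0) (cov_deriv_along_skew X Y Z)) (oppE _).
Qed.

End Immersion.

(** * Linear algebra of tangent and normal spaces *)

Section Orthogonal.
Variables (R : realType) (k n : nat) (T : 'M[R]_(k, n)) (G : 'M[R]_n).

(** A common vector is orthogonal to itself, hence zero by positivity. *)
Lemma kermx_cap_genmx_eq0 :
  positive_definite G -> (kermx (G *m T^T) :&: <<T>>)%MS = 0.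
Proof.
move=> pG; apply/eqP/rowV0P => v; rewrite sub_capmx genmxE => /andP[vN /submxP[a vT]].
apply/eqP/negP => /negP /pG; rewrite {2}vT trmx_mul mulmxA -[v *m G *m _]mulmxA.
by rewrite (sub_kermxP vN) mul0mx mxE ltxx.
Qed.

(** The kernel consists of the [v] with g(P v, T) = 0. It contains [T] by isotropy and has rank
    [n - k = k], so the two coincide. *)
Lemma isotropic_half_dim_kermx (P : 'M[R]_n) :
  P \in unitmx -> G \in unitmx -> row_free T -> (n - k = k)%N ->
  T *m P *m G *m T^T = 0 -> (T :=: kermx (P *m G *m T^T))%MS.
Proof.
move=> uP uG fT nk T0; apply/eqmxP; rewrite -(mxrank_leqif_eq _).2; last first.
  by apply/sub_kermxP; rewrite !mulmxA.
rewrite mxrank_ker (eqP fT) -mxrank_tr trmx_mul trmxK mxrankMfree ?(eqP fT) ?nk//.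
by rewrite row_free_unit unitmx_tr unitmx_mul uP.
Qed.

End Orthogonal.

(** * The almost product structure is invertible, self-adjoint and parallel *)

Section AlmostProduct.
Variables (R : realType) (p q : nat) (M : riemannian R p) (N : riemannian R q).
Implicit Type j : atlas_index (riemannian_prod M N).

Lemma almost_productE j y : almost_product M N j y = block_mx 1%:M 0 0 (- 1%:M).
Proof.
rewrite /almost_product /proj_left /proj_right opp_block_mx add_block_mx.
by rewrite !oppr0 !addr0 add0r.
Qed.

Lemma almost_product_tr j y : (almost_product M N j y)^T = almost_product M N j y.
Proof. by rewrite almost_productE tr_block_mx linearN /= !trmx1 !trmx0. Qed.

Lemma almost_product_unitmx j y : almost_product M N j y \in unitmx.
Proof.
apply: (mulmx1_unit (B := almost_product M N j y) _).1.
rewrite almost_productE mulmx_block !(mulmx0, mul0mx, addr0, add0r, mulmx1).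
by rewrite mulNmx mul1mx opprK -scalar_mx_block.
Qed.

(** The structure is 1 on one factor and -1 on the other, hence a scalar on each diagonal block.
    Both the product metric and its Christoffel matrices are block diagonal. *)
Lemma almost_product_block_comm j y (A : 'M[R]_p) (D : 'M[R]_q) :
  almost_product M N j y *m block_mx A 0 0 D = block_mx A 0 0 D *m almost_product M N j y.
Proof.
rewrite almost_productE !mulmx_block !(mulmx0, mul0mx, addr0, add0r, mulmx1, mul1mx).
by rewrite mulNmx mulmxN mulmx1 mul1mx.
Qed.

Lemma almost_product_metric j y :
  almost_product M N j y *m metric j y = metric j y *m (almost_product M N j y)^T.
Proof. by rewrite almost_product_tr; exact: almost_product_block_comm. Qed.

Lemma almost_product_christoffel j y c : cod (atlas j) y ->
  almost_product M N j y *m christoffel (metric j) y c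
  = christoffel (metric j) y c *m almost_product M N j y.
Proof.
move=> [cu du].
have dG := smooth_differentiable (@metric_smooth _ _ M j.1) cu.
have dH := smooth_differentiable (@metric_smooth _ _ N j.2) du.
have uG := metric_unitmx cu; have uH := metric_unitmx du.
have := fintype.splitK c; case: (fintype.split c) => c' /= <-.
  have E : christoffel (metric j) y (lshift q c') = block_mx _ 0 0 0 :=
    christoffel_lshift dG dH uG uH c'.
  by rewrite E; exact: almost_product_block_comm.
have E : christoffel (metric j) y (rshift p c') = block_mx 0 0 0 _ :=
  christoffel_rshift dG dH uG uH c'.
by rewrite E; exact: almost_product_block_comm.
Qed.

End AlmostProduct.

(** * Regularity of the inclusion in charts *)

Section LocalInclusion.
Variables (R : realType) (k n : nat) (B : manifold R n) (S : submanifold k B).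
Variables (i : atlas_index S) (j : atlas_index B).

Let U : set 'rV[R]_k :=
  [set u | cod (atlas i) u /\ dom (atlas j) (incl (param (atlas i) u))].

Lemma chart_pair_coord x : chart_pair i j x -> U (coord (atlas i) x).
Proof. by move=> [ix jx]; split; [exact: coord_cod|rewrite coordK]. Qed.

Lemma chart_pair_param u : U u -> chart_pair i j (param (atlas i) u).
Proof. by move=> [iu ju]; split=> //; exact: param_dom. Qed.

Lemma local_inclE x : chart_pair i j x ->
  local_incl i j (coord (atlas i) x) = coord (atlas j) (incl x).
Proof. by move=> [ix _]; rewrite /local_incl /= coordK. Qed.

Lemma near_chart_pair x : chart_pair i j x ->
  \forall u \near coord (atlas i) x, U u.
Proof.
move=> [ix jx]; apply: filterI.
  by apply: open_nbhs_nbhs; split; [exact: open_cod|exact: coord_cod].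
have cp := chart_param_continuous (coord_cod ix).
have ci : {for coord (atlas i) x, continuous (@incl _ _ _ _ S \o param (atlas i))}.
  by apply: continuous_comp => //; exact: incl_continuous.
apply: ci; apply: open_nbhs_nbhs; split; first exact: open_dom.
by rewrite /= coordK.
Qed.

Lemma local_incl_differentiable u : U u -> differentiable (local_incl i j) u.
Proof. exact: smooth_differentiable (incl_smooth i j). Qed.

(** Smoothness speaks only of derivatives along basis vectors, so ['D_Y] is first expanded near the
    point as a combination of these. *)
Lemma derive_local_incl_differentiable x Y : chart_pair i j x ->
  differentiable ('D_Y (local_incl i j)) (coord (atlas i) x).
Proof.
move=> ijx; have Ux := chart_pair_coord ijx.
apply: (@near_eq_differentiable _ _ _
  (\sum_c (Y 0 c *: 'D_('e_c) (local_incl i j)))).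
  apply: filterS (near_chart_pair ijx) => u /local_incl_differentiable df.
  by rewrite fct_sumE [RHS](derive_row_sum _ df).
apply: differentiable_sum => c; apply: differentiableZ.
by have [_ /(_ c)[+ _]] := incl_smooth i j 2; exact.
Qed.

End LocalInclusion.

(** * From orthogonality to the vanishing of the second fundamental form *)

Theorem theorem4p2 (R : realType) (m n k : nat)
    (Mm : kahler R (2 * m)) (Mn : kahler R (2 * n))
    (M : submanifold k (kahler_prod Mm Mn))
    (M_anti_invariant : anti_invariant M (almost_product Mm Mn))
    (M_lagrangian : lagrangian M) :
  totally_geodesic M.
Proof.
move=> i j x X Y ijx; have [ix jx] := ijx.
set f := local_incl i j; set u := coord (atlas i) x; pose T := tangent_mx i j x.
have fu : f u = coord (atlas j) (incl x) by exact: local_inclE.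
have cfu : cod (atlas j) (f u) by rewrite fu; exact: coord_cod.
have df := local_incl_differentiable (chart_pair_coord ijx).
pose P := almost_product Mm Mn j (f u); pose G := metric j (f u).
have uG : G \in unitmx by exact: metric_unitmx.
have uP : P \in unitmx by exact: almost_product_unitmx.
have fT : row_free T by exact: incl_immersion.
have anti y : chart_pair i j y ->
    tangent_mx i j y *m almost_product Mm Mn j (coord (atlas j) (incl y))
      *m metric j (coord (atlas j) (incl y)) *m (tangent_mx i j y)^T = 0.
  by move=> ijy; rewrite -mulmxA; exact/sub_kermxP/M_anti_invariant.
have nablaPG Z : cov_deriv_along (metric j) f ('D_Y f) u X *m P *m G *m ('D_Z f u)^T = 0.
  apply: second_derivative_orthogonal => [|||||c||{}Y {}Z].
  - by apply: filterS (near_chart_pair ijx) => v /local_incl_differentiable.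
  - by move=> W; exact: derive_local_incl_differentiable.
  - exact: smooth_differentiable (metric_smooth j) cfu.
  - have : \forall y \near f u, cod (atlas j) y.
      by apply: open_nbhs_nbhs; split; first exact: open_cod.
    by apply: filterS => y /metric_sym.
  - exact: uG.
  - exact: almost_product_christoffel.
  - exact: almost_product_metric.
  (* Anti-invariance is transported to every nearby coordinate vector [v], through the point
     [param (atlas i) v], with ['D_Y f v] written as [Y] times the Jacobian. *)
  - apply: filterS (near_chart_pair ijx) => v Uv.
    have ijv := chart_pair_param Uv; have := anti _ ijv.
    have [iv _] := Uv; have dv := local_incl_differentiable Uv.
    rewrite -(local_inclE ijv) /tangent_mx paramK// => E.
    rewrite (deriveEjacobian _ dv) (deriveEjacobian _ dv) trmx_mul.
    by rewrite -!(mulmxA Y) mulmxA !(mulmxA _ _ Z^T) -!(mulmxA Y) E mul0mx mulmx0.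
(* It suffices that the covariant derivative be tangent, since the projection to the normal space
   along [T] then kills it. *)
have nablaT : (cov_deriv_along (metric j) f ('D_Y f) u X <= T)%MS.
  (* Rank comparison in the Lagrangian condition: [T] times the invertible complex structure has
     rank [k], the normal space has rank [2 * m + 2 * n - k]. *)
  have nk : (2 * m + 2 * n - k = k)%N.
    have uJ : cplx j (f u) \in unitmx.
      have JJ : cplx j (f u) *m - cplx j (f u) = 1%:M.
        by rewrite mulmxN (cplx_square cfu) opprK.
      by have [] := mulmx1_unit JJ.
    have := (M_lagrangian _ _ _ ijx).1.
    rewrite -fu mxrankMfree ?row_free_unit// (eqP fT).
    rewrite mxrank_ker -fu -mxrank_tr trmx_mul trmxK mxrankMfree ?(eqP fT)//.
    by rewrite row_free_unit unitmx_tr.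
  rewrite (isotropic_half_dim_kermx uP uG fT nk); last first.
    by rewrite /G /P fu; exact: anti.
  (* Taking [Z] to be the c-th basis vector in [nablaPG] gives the c-th entry. *)
  apply/sub_kermxP/rowP => c.
  have := nablaPG 'e_c; rewrite (deriveEjacobian _ df) trmx_mul trmx_delta !mulmxA -colE.
  by move=> /(congr1 (fun A : 'M[R]_1 => A 0 0)); rewrite !mxE.
apply: proj_mx_0; last by rewrite genmxE.
by apply: kermx_cap_genmx_eq0; apply: metric_pos; rewrite -fu.
Qed.
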